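(* Let $\alpha\ge0$ and let $\theta_{\alpha,n}=T_\alpha(P_n)$ be the power pseudodistance estimator of order $\alpha$. If its influence function exists at $Q\in\mathcal P^+$, or at $P_\theta\in\mathcal P$, then it is given by the formula $$\mathrm{IF}(x;T_\alpha,Q)=-\boldsymbol I_\alpha(Q)^{-1}\left[p_{\tau_\alpha}^\alpha(x)\,s_{\tau_\alpha}(x)-P_{\tau_\alpha}\cdot p_{\tau_\alpha}^\alpha s_{\tau_\alpha}\right]\quad\text{for }\tau_\alpha=T_\alpha(Q),$$ or $$\mathrm{IF}(x;T_\alpha,\theta)=-\boldsymbol I_\alpha(\theta)^{-1}\left[p_\theta^\alpha(x)\,s_\theta(x)-P_\theta\cdot p_\theta^\alpha s_\theta\right],$$ respectively, where $$\boldsymbol I_\alpha(Q)=Q\cdot\Pi_{\alpha,\tau_\alpha}-P_{\tau_\alpha}\cdot\left(\Pi_{\alpha,\tau_\alpha}+p_{\tau_\alpha}^\alpha s_{\tau_\alpha}s_{\tau_\alpha}^{\rm t}\right),\qquad \Pi_{\alpha,\theta}=p_\theta^\alpha\left(\alpha s_\theta s_\theta^{\rm t}+\mathring s_\theta\right),$$ $$\boldsymbol I_\alpha(\theta)=\boldsymbol I_\alpha(P_\theta)=-P_\theta\cdot p_\theta^\alpha s_\theta s_\theta^{\rm t}.$$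
   Context: $\mathcal P=\{P_\theta:\theta\in\Theta\}$, $\Theta\subset\mathbb R^d$, is an identifiable family of nonatomic, mutually equivalent probability measures on a measurable space $(\mathcal X,\mathcal A)$ with densities $p_\theta=\mathrm dP_\theta/\mathrm d\lambda$, $\lambda$ $\sigma$-finite; $P_0\notin\mathcal P$ is a probability measure equivalent with the members of $\mathcal P$; $\mathcal P^+=\mathcal P\cup\{P_0\}$; $\mathcal P_{\rm emp}$ is the set of empirical measures $P_n=\frac1n\sum_{i=1}^n\delta_{X_i}$; $\mathcal Q=\mathcal P^+\cup\mathcal P_{\rm emp}$; $Q\cdot f=\int f\,\mathrm dQ$; $Q_{\varepsilon,x}=(1-\varepsilon)Q+\varepsilon\delta_x$. Power pseudodistance estimator of order $\alpha$: $\theta_{\alpha,n}=T_\alpha(P_n)$ with $$T_\alpha(Q)=\begin{cases}\mathrm{argmin}_\theta\left[\frac1{1+\alpha}\int p_\theta^{1+\alpha}\,\mathrm d\lambda-\frac1\alpha Q\cdot p_\theta^\alpha\right]&\alpha>0,\\ \mathrm{argmax}_\theta\,Q\cdot\ln p_\theta&\alpha=0,\end{cases}$$ for $Q\in\mathcal Q$ and for the mixtures $Q_{\varepsilon,x}$. The densities are twice differentiable in $\theta$; $s_\theta=\frac{\mathrm d}{\mathrm d\theta}\ln p_\theta$ (a column vector here) and $\mathring s_\theta=\left(\frac{\mathrm d}{\mathrm d\theta}\right)^{\rm t}s_\theta$ (a $d\times d$ matrix), ${}^{\rm t}$ denoting transpose. $T_\alpha(Q)$ solves in $\theta$ the equation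 $Q\cdot\psi_\alpha(\cdot,\theta)=0$ for $\psi_\alpha(x,\theta)=p_\theta^\alpha(x)s_\theta(x)-P_\theta\cdot p_\theta^\alpha s_\theta$. The expectations occurring are assumed to exist, differentiation in $\theta$ and integration to be interchangeable, and the matrices $\boldsymbol I_\alpha$ to be invertible. Influence function: $\mathrm{IF}(x;T,Q)=\lim_{\varepsilon\downarrow0}\varepsilon^{-1}\left(T(Q_{\varepsilon,x})-T(Q)\right)$; it exists at $Q$ if these limits exist for all $x\in\mathcal X$. $\mathrm{IF}(x;T,\theta)=\mathrm{IF}(x;T,P_\theta)$. *)

(* Defs.v *)
From HB Require Import structures.
From mathcomp Require Import all_boot all_order all_algebra.
From mathcomp Require Import all_classical all_reals all_analysis.

Set Implicit Arguments.
Unset Strict Implicit.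
Unset Printing Implicit Defensive.

Import Order.TTheory GRing.Theory Num.Theory.
Import numFieldNormedType.Exports.

Local Open Scope classical_set_scope.
Local Open Scope ring_scope.

Section calculus.
Context {R : realType} {d : nat}.

Definition grad (f : 'cV[R]_d -> R) (t : 'cV[R]_d) : 'cV[R]_d :=
  \col_i 'D_(delta_mx i 0) f t.

Definition jacobian_mx (g : 'cV[R]_d -> 'cV[R]_d) (t : 'cV[R]_d) : 'M[R]_d :=
  \matrix_(i, j) 'D_(delta_mx j 0) (fun u => g u i 0) t.

Definition twice_differentiable (f : 'cV[R]_d -> R) (t : 'cV[R]_d) : Prop :=
  (\forall u \near t, differentiable f u) /\ differentiable (grad f) t.

End calculus.

Section measures.
Context {disp : measure_display} {X : measurableType disp} {R : realType}.

Definition eq_measure (m1 m2 : set X -> \bar R) : Prop :=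
  forall A, measurable A -> m1 A = m2 A.

Definition equivalent_measures (m1 m2 : set X -> \bar R) : Prop :=
  m1 `<< m2 /\ m2 `<< m1.

Definition nonatomic (m : set X -> \bar R) : Prop :=
  forall A, measurable A -> (0 < m A)%E ->
  exists B, [/\ measurable B, B `<=` A, (0 < m B)%E & (m B < m A)%E].

Definition is_density (lambda : {measure set X -> \bar R})
    (m : set X -> \bar R) (f : X -> R) : Prop :=
  [/\ measurable_fun setT f, forall x, 0 <= f x &
      forall A, measurable A -> m A = (\int[lambda]_(x in A) (f x)%:E)%E].

(* Entrywise expectation mu . F of a matrix-valued function. *)
Definition expect (mu : {measure set X -> \bar R}) {m n : nat}
    (F : X -> 'M[R]_(m, n)) : 'M[R]_(m, n) :=
  \matrix_(i, j) \int[mu]_x F x i j.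

Definition expect_exists (mu : {measure set X -> \bar R}) {m n : nat}
    (F : X -> 'M[R]_(m, n)) : Prop :=
  forall i j, mu.-integrable setT (fun x => (F x i j)%:E).

(* Differentiation and integration can be interchanged at [t] for the family
   [F]: the integral is (totally) differentiable at [t], with derivative the
   integral of the derivative. *)
Definition interchangeable (mu : {measure set X -> \bar R}) {d : nat}
    (F : 'cV[R]_d -> X -> 'cV[R]_d) (t : 'cV[R]_d) : Prop :=
  differentiable (fun u => expect mu (F u)) t /\
  jacobian_mx (fun u => expect mu (F u)) t =
  expect mu (fun x => jacobian_mx (F ^~ x) t).

Definition clamp01 (e : R) : R := Num.max 0 (Num.min 1 e).

Lemma clamp01_ge0 (e : R) : 0 <= clamp01 e.
Proof. by rewrite /clamp01 le_max lexx. Qed.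

Lemma onem_clamp01_ge0 (e : R) : 0 <= 1 - clamp01 e.
Proof. by rewrite subr_ge0 /clamp01 ge_max ler01 ge_min lexx. Qed.

(* Q_{e,x} = (1 - e) Q + e delta_x.  The weight is clamped to [0, 1] only to
   make it a probability for every real e; clamp01 e = e when 0 <= e <= 1. *)
Definition contamination (Q : probability X R) (e : R) (x : X) :
    set X -> \bar R :=
  measure_add (mscale (NngNum (onem_clamp01_ge0 e)) Q)
              (mscale (NngNum (clamp01_ge0 e)) (dirac x)).

Lemma contaminationE (Q : probability X R) (e : R) (x : X) (A : set X) :
  contamination Q e x A = ((1 - clamp01 e)%:E * Q A + (clamp01 e)%:E * \d_x A)%E.
Proof. exact: measure_addE. Qed.

Lemma contamination_setT (Q : probability X R) (e : R) (x : X) :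
  contamination Q e x setT = 1%E.
Proof.
by rewrite contaminationE probability_setT diracT !mule1 -EFinD subrK.
Qed.

HB.instance Definition _ (Q : probability X R) (e : R) (x : X) :=
  Measure.on (contamination Q e x).

HB.instance Definition _ (Q : probability X R) (e : R) (x : X) :=
  Measure_isProbability.Build _ _ _ (contamination Q e x)
    (contamination_setT Q e x).

Definition is_empirical (Q : probability X R) : Prop :=
  exists n (xs : 'I_n.+1 -> X), forall A, measurable A ->
    Q A = ((n.+1%:R^-1)%:E * \sum_(i < n.+1) \d_(xs i) A)%E.

End measures.

Section influence.
Context {disp : measure_display} {X : measurableType disp} {R : realType}.
Context {d : nat}.
Variable T : probability X R -> 'cV[R]_d.

Definition influence_quotient (Q : probability X R) (x : X) (e : R) :
    'cV[R]_d :=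
  e^-1 *: (T (contamination Q e x) - T Q).

Definition influence_exists (Q : probability X R) : Prop :=
  forall x, cvg (influence_quotient Q x e @[e --> 0^'+]).

Definition IF (x : X) (Q : probability X R) : 'cV[R]_d :=
  lim (influence_quotient Q x e @[e --> 0^'+]).

End influence.

Section power_pseudodistance.
Context {disp : measure_display} {X : measurableType disp} {R : realType}.
Context {d : nat}.
Variable lambda : {sigma_finite_measure set X -> \bar R}.
Variable Theta : set 'cV[R]_d.
Variable P : 'cV[R]_d -> probability X R.
Variable P0 : probability X R.
Variable p : 'cV[R]_d -> X -> R.
Variable alpha : R.

(* P and p are total on R^d, but only their values on Theta are constrained to
   form the model; derivatives at a point of Theta are derivatives in R^d. *)
Definition model_family : Prop :=
  [/\ forall t, Theta t -> is_density lambda (P t) (p t),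
      forall t, Theta t -> nonatomic (P t),
      forall t u, Theta t -> Theta u -> equivalent_measures (P t) (P u) &
      forall t u, Theta t -> Theta u -> eq_measure (P t) (P u) -> t = u].

Definition true_measure : Prop :=
  (forall t, Theta t -> ~ eq_measure P0 (P t)) /\
  (forall t, Theta t -> equivalent_measures P0 (P t)).

(* Positivity is what makes ln p_t(x), hence s_t(x), meaningful at each x. *)
Definition smooth_densities : Prop :=
  forall t x, Theta t -> 0 < p t x /\ twice_differentiable (p ^~ x) t.

Definition calPplus (Q : probability X R) : Prop :=
  (exists2 t, Theta t & Q = P t) \/ Q = P0.

Definition calQ (Q : probability X R) : Prop := calPplus Q \/ is_empirical Q.

Definition calQ_mix (Q : probability X R) : Prop :=
  calQ Q \/
  exists Q' e x, [/\ calQ Q', 0 < e < 1 & Q = contamination Q' e x].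

Definition score (t : 'cV[R]_d) (x : X) : 'cV[R]_d :=
  grad (fun u => ln (p u x)) t.

Definition dscore (t : 'cV[R]_d) (x : X) : 'M[R]_d :=
  jacobian_mx (score ^~ x) t.

Definition pscore (t : 'cV[R]_d) (x : X) : 'cV[R]_d :=
  p t x `^ alpha *: score t x.

Definition psi (x : X) (t : 'cV[R]_d) : 'cV[R]_d :=
  pscore t x - expect (P t) (pscore t).

Definition pss (t : 'cV[R]_d) (x : X) : 'M[R]_d :=
  p t x `^ alpha *: (score t x *m (score t x)^T).

Definition Pi_mx (t : 'cV[R]_d) (x : X) : 'M[R]_d :=
  p t x `^ alpha *: (alpha *: (score t x *m (score t x)^T) + dscore t x).

Definition criterion (Q : probability X R) (t : 'cV[R]_d) : R :=
  (1 + alpha)^-1 * (\int[lambda]_x (p t x `^ (1 + alpha))) -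
  alpha^-1 * (\int[Q]_x (p t x `^ alpha)).

Definition loglik (Q : probability X R) (t : 'cV[R]_d) : R :=
  \int[Q]_x ln (p t x).

(* t is a value of T_alpha(Q): argmin if alpha > 0, argmax if alpha = 0. *)
Definition power_estimate (Q : probability X R) (t : 'cV[R]_d) : Prop :=
  Theta t /\
  if alpha == 0 then forall u, Theta u -> loglik Q u <= loglik Q t
  else forall u, Theta u -> criterion Q t <= criterion Q u.

Definition power_functional (T : probability X R -> 'cV[R]_d) : Prop :=
  forall Q, calQ_mix Q -> power_estimate Q (T Q).

(* Not a consequence of optimality when T Q is a boundary point of Theta. *)
Definition solves_estimating_equation (T : probability X R -> 'cV[R]_d) :
    Prop :=
  forall Q, calQ_mix Q -> expect Q (psi ^~ (T Q)) = 0.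

Definition expectations_exist : Prop :=
  forall t, Theta t ->
  [/\ lambda.-integrable setT (fun x => (p t x `^ (1 + alpha))%:E),
      expect_exists (P t) (pss t) &
      forall Q, calPplus Q ->
      [/\ Q.-integrable setT
            (fun x => (if alpha == 0 then ln (p t x)
                       else p t x `^ alpha)%:E),
          expect_exists Q (pscore t) & expect_exists Q (Pi_mx t)]].

(* The integral of p_t^(1+alpha) s_t d(lambda) equals P_t . p_t^alpha s_t. *)
Definition derivative_integral_interchange : Prop :=
  forall t, Theta t ->
  interchangeable lambda
    (fun u x => p u x `^ (1 + alpha) *: score u x) t /\
  forall Q, calPplus Q -> interchangeable Q pscore t.

Definition I_mx (T : probability X R -> 'cV[R]_d) (Q : probability X R) :
    'M[R]_d :=
  expect Q (Pi_mx (T Q)) -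
  expect (P (T Q)) (fun x => Pi_mx (T Q) x + pss (T Q) x).

Definition I_model (t : 'cV[R]_d) : 'M[R]_d := - expect (P t) (pss t).

End power_pseudodistance.

(* Main.v *)
Require Import Defs.
From HB Require Import structures.
From mathcomp Require Import all_boot all_order all_algebra.
From mathcomp Require Import all_classical all_reals all_analysis.
From mathcomp Require Import measurable_realfun ring lra.
Set Implicit Arguments.
Unset Strict Implicit.
Unset Printing Implicit Defensive.

Import Order.TTheory GRing.Theory Num.Theory.
Import numFieldNormedType.Exports.
Local Open Scope classical_set_scope.
Local Open Scope ring_scope.

(** The vector [psi(x, theta)] splits into [pscore theta x], which is averaged
    against [Q], minus the model term
    [K(theta) = P_theta . p_theta^alpha s_theta].  Writing [G(theta)] for
    [Q . p_theta^alpha s_theta] and [h(e) = T(Q_{e,x})], the estimating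
    equations at [Q] and at [Q_{e,x}] read [G(T Q) = K(T Q)] and
    [(1 - e) G(h e) + e p^alpha s(x) = K(h e)], the score term being taken at
    [h e].  Subtracting and dividing by [e],

      (G(h e) - G(T Q)) / e - (K(h e) - K(T Q)) / e = G(h e) - p^alpha s(x).

    When the influence function exists, [(h e - T Q) / e] tends to [IF], so the
    left side tends to [dG(IF) - dK(IF)] ([cvg_quotient_diff]) and the
    right side to [-psi(x, T Q)].  The differentials are computed under the
    integral sign ([jacobian_powR_score]): [dG] is the matrix [Q . Pi], and
    [dK] is [P_theta . (Pi + p^alpha s s^t)].  For [dK] the measure depends on
    the parameter too; on [Theta] this is removed by writing [K] as the
    [lambda]-integral of [p^(1+alpha) s] ([expect_density]).  This gives
    [I_mx T Q *m IF = - psi] ([influence_equation]), to be solved for [IF].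

    The formula at [P_theta] also needs [T (P theta) = theta].  This is
    Fisher consistency ([power_estimate_model]): the excess of the criterion
    (minus the log-likelihood when [alpha = 0]) over its value at [theta] is,
    up to a positive factor, the integral of a pointwise gap between the
    densities ([kl_gap_gt0], [power_gap_gt0]) which is positive unless they
    coincide, so a minimizer has the same density almost everywhere and
    identifiability applies. *)

(** * Differential calculus *)

Section calculus.
Context {R : realType}.

(** The chain rule for a path [h] known only through its one-sided derivative
    [l]: since the quotients of [h] stay bounded, the remainder of the totally
    differentiable [f] is negligible along [h]. *)
Lemma cvg_quotient_diff (V W : normedModType R) (f : V -> W) (t l : V)
    (h : R -> V) : differentiable f t ->
  e^-1 *: (h e - t) @[e --> 0^'+] --> l ->
  e^-1 *: (f (h e) - f t) @[e --> 0^'+] --> 'd f t l.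
Proof.
move=> df hl.
have hE (e : R) : 0 < e -> h e = e *: (e^-1 *: (h e - t)) + t.
  by move=> e0; rewrite scalerA divff ?gt_eqF// scale1r subrK.
have ht : e *: (e^-1 *: (h e - t)) @[e --> 0^'+] --> (0 : V).
  rewrite -(scale0r l); apply: cvgZ hl.
  exact: cvg_at_right_filter cvg_id.
have fE := diff_locallyx df.
set r := 'o _ in fE.
have rl : e^-1 *: (r (e *: (e^-1 *: (h e - t)))) @[e --> 0^'+] --> (0 : W).
  apply/cvgr0Pnorm_lt => eps eps0.
  (* The quotients of [h] are eventually bounded by [`|l| + 1]. *)
  have C0 : 0 < `|l| + 1 by rewrite ltr_wpDl.
  have near_r : \forall e \near 0^'+,
      `|r (e *: (e^-1 *: (h e - t)))| <=
      (eps / (`|l| + 1)) * `|e *: (e^-1 *: (h e - t))|.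
    have := littleoP [littleo of r] (divr_gt0 eps0 C0).
    exact: ht.
  have near_l : \forall e \near 0^'+, `|e^-1 *: (h e - t)| < `|l| + 1.
    by move/cvg_norm/cvgr_lt : hl; apply; rewrite ltrDl.
  near=> e.
  have e0 : 0 < e by near: e; exact: nbhs_right_gt.
  rewrite normrZ gtr0_norm ?invr_gt0// mulrC ltr_pdivrMr//.
  have re : `|r (e *: (e^-1 *: (h e - t)))| <=
      (eps / (`|l| + 1)) * `|e *: (e^-1 *: (h e - t))| by near: e.
  apply: (le_lt_trans re); rewrite [X in _ * X]normrZ (gtr0_norm e0).
  rewrite mulrCA mulrC ltr_pM2r// mulrAC ltr_pdivrMr// ltr_pM2l//.
  by near: e.
have dl : 'd f t (e^-1 *: (h e - t)) @[e --> 0^'+] --> 'd f t l.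
  have cd : {for l, continuous ('d f t)} by apply: (diff_continuous df).
  exact: (cvg_comp _ _ hl cd).
have FF : Filter (0 : R)^'+ by exact: filter_filter.
have := cvgD dl rl; rewrite addr0 => /(_ FF) lim.
suff near_sum : \forall e \near 0^'+, 'd f t (e^-1 *: (h e - t)) +
    e^-1 *: (r (e *: (e^-1 *: (h e - t)))) = e^-1 *: (f (h e) - f t).
  exact: cvg_trans (near_eq_cvg near_sum) lim.
near=> e.
have e0 : 0 < e by near: e; exact: nbhs_right_gt.
rewrite [in RHS](hE _ e0) fE -[f t + _ + _]addrA [f t + _]addrC addrK.
set q := e^-1 *: (h e - t).
have -> : 'd f t (e *: q) = e *: 'd f t q by rewrite linearZ.
by rewrite scalerDr scalerA mulVf ?gt_eqF// scale1r.
Unshelve. all: by end_near. Qed.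

Lemma diff_jacobian_mx {d : nat} (f : 'cV[R]_d -> 'cV[R]_d) (t v : 'cV[R]_d) :
  differentiable f t -> 'd f t v = jacobian_mx f t *m v.
Proof.
move=> df; apply/colP => i.
rewrite [in LHS](matrix_sum_delta v) linear_sum/= summxE !mxE.
apply: eq_bigr => j _; rewrite big_ord1 linearZ/= mxE mulrC; congr (_ * _).
by rewrite -deriveE// derive_mx ?mxE//; exact: diff_derivable.
Qed.

Lemma derive_comp_real (V : normedModType R) (phi : R -> R) (f : V -> R)
    (t v : V) (dphi : R) :
  differentiable f t -> is_derive (f t) 1 phi dphi ->
  differentiable (phi \o f) t /\ 'D_v (phi \o f) t = dphi * 'D_v f t.
Proof.
move=> df [dp <-].
have dp' : differentiable phi (f t) by exact/derivable1_diffP.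
have dpf : differentiable (phi \o f) t by exact: differentiable_comp.
split; first exact: dpf.
rewrite (deriveE _ dpf) (deriveE _ dp') (deriveE _ df).
have -> : 'd (phi \o f) t v = 'd phi (f t) ('d f t v).
  by have /= -> := diff_comp df dp'.
have -> : 'd f t v = 'd f t v *: (1 : R) by rewrite -[_ *: _]/(_ * _) mulr1.
have -> : 'd phi (f t) ('d f t v *: (1 : R)) = 'd f t v *: 'd phi (f t) 1.
  by rewrite linearZ.
by rewrite -[_ *: 1]/(_ * _) mulr1 mulrC.
Qed.

End calculus.

(** * The score and its weighted versions *)

Section power_score.
Context {R : realType} {d : nat}.
Variables (g : 'cV[R]_d -> R) (t : 'cV[R]_d).
Hypotheses (gt0 : 0 < g t) (g2 : twice_differentiable g t).

Let s u := grad (fun w => ln (g w)) u.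

Let dg : differentiable g t.
Proof. by case: g2 => /nbhs_singleton. Qed.

(** The score is the gradient of [ln g]; the quotient form is only available
    near [t], where [g] is known to be positive and differentiable, which is
    enough for derivatives and limits at [t]. *)
Lemma near_score : \forall u \near t, s u = (g u)^-1 *: grad g u.
Proof.
case: g2 => near_dg _.
have gpos : \forall u \near t, 0 < g u.
  exact: (cvgr_gt _ (differentiable_continuous dg)).
near=> u.
have gu : 0 < g u by near: u.
have du : differentiable g u by near: u.
apply/colP => i; rewrite !mxE.
by have [_ ->] := derive_comp_real (delta_mx i 0) du (is_derive1_ln gu).
Unshelve. all: by end_near. Qed.

Lemma differentiable_powR (a : R) (v : 'cV[R]_d) :
  differentiable (fun u => g u `^ a) t /\
  'D_v (fun u => g u `^ a) t = a * g t `^ (a - 1) * 'D_v g t.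
Proof. exact: derive_comp_real (is_derive1_powR a gt0). Qed.

Lemma derivable_score i v : derivable (fun u => s u i 0) t v.
Proof.
apply: (@near_eq_derivable _ _ _ (fun u => (g u)^-1 * grad g u i 0)).
  by apply: filterS near_score => u ->; rewrite [RHS]mxE.
apply: derivableM.
  by apply: derivableV; [rewrite gt_eqF|exact: diff_derivable].
case: g2 => _ /(diff_derivable (v := v)).
by move/derivable_mxP => /(_ i 0).
Qed.

(** With [a = alpha] the right-hand side is [Pi_mx]; with [a = 1 + alpha] it is
    the density times [Pi_mx + pss], the extra [s s^t] coming from the factor
    [p]. *)
Lemma jacobian_powR_score (a : R) :
  jacobian_mx (fun u => g u `^ a *: s u) t =
  g t `^ a *: (a *: (s t *m (s t)^T) + jacobian_mx s t).
Proof.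
apply/matrixP => i j; rewrite !mxE big_ord1.
under eq_fun do rewrite mxE.
have [dpow Dpow] := differentiable_powR a (delta_mx j 0).
rewrite deriveM//; [|exact: diff_derivable|exact: derivable_score].
rewrite Dpow.
have sE : s t = (g t)^-1 *: grad g t by exact: nbhs_singleton near_score.
have -> : 'D_(delta_mx j 0) g t = g t * s t j 0.
  by rewrite sE !mxE mulrA divff ?gt_eqF// mul1r.
(* The derivative of [g `^ a] is [a g^a] times the score. *)
have powE : g t `^ (a - 1) * g t = g t `^ a.
  have -> : g t `^ (a - 1) = g t `^ a / g t `^ 1.
    by rewrite powRB// (gt_eqF gt0) implybT.
  by rewrite powRr1 ?ltW// divfK// gt_eqF.
rewrite -[a * _ * _]mulrA [g t `^ (a - 1) * _]mulrA powE.
rewrite [(s t)^T _ _]mxE /GRing.scale/=.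
ring.
Qed.

Lemma continuous_powR_score (a : R) :
  {for t, continuous (fun u => g u `^ a *: s u)}.
Proof.
have tF : Filter (nbhs t) by exact: nbhs_filter.
have cpow : g u `^ a @[u --> t] --> g t `^ a.
  have [dpow _] := differentiable_powR a 0.
  exact: (differentiable_continuous dpow).
have cg : g u @[u --> t] --> g t := differentiable_continuous dg.
have cgrad : grad g u @[u --> t] --> grad g t.
  by case: g2 => _ /differentiable_continuous.
have glim : (g u)^-1 *: grad g u @[u --> t] --> (g t)^-1 *: grad g t.
  exact: cvgZ (cvgV (lt0r_neq0 gt0) cg) cgrad.
have near_sE : \forall u \near t, (g u)^-1 *: grad g u = s u.
  by apply: filterS near_score => u ->.
have slim : s u @[u --> t] --> s t.
  rewrite -(nbhs_singleton near_sE).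
  exact: cvg_trans (near_eq_cvg near_sE) glim.
exact: cvgZ cpow slim.
Qed.

End power_score.

(** * Change of measure and contaminated measures *)

Section measures.
Context {disp : measure_display} {X : measurableType disp} {R : realType}.

Section density.
Variables (lambda : {sigma_finite_measure set X -> \bar R}).
Variables (m : probability X R) (p : X -> R).
Hypothesis mp : is_density lambda m p.

Let measurable_p : measurable_fun setT p.
Proof. by case: mp. Qed.

Let p_ge0 x : 0 <= p x.
Proof. by case: mp. Qed.

Lemma density_dominates : m `<< lambda.
Proof.
apply/null_content_dominatesP => A mA A0; case: mp => _ _ ->//.
apply: null_set_integral => //.
by apply/measurable_EFinP; exact: measurable_funS measurable_p.
Qed.

Lemma density_integrable : lambda.-integrable setT (EFin \o p).
Proof.
apply/integrableP; split; first exact/measurable_EFinP.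
under eq_integral do rewrite /= ger0_norm//.
case: mp => _ _ <-//.
by rewrite probability_setT ltry.
Qed.

(** A density agrees almost everywhere with the Radon-Nikodym derivative, for
    which the formula is known. *)
Lemma ge0_integral_density (g : X -> \bar R) : measurable_fun setT g ->
  (forall x, 0 <= g x)%E ->
  (\int[m]_x g x = \int[lambda]_x (g x * (p x)%:E))%E.
Proof.
move=> mg g0; have mlam := density_dominates.
rewrite -(Radon_Nikodym_SigmaFinite.change_of_variables mlam g0)//.
have int_rn := Radon_Nikodym_SigmaFinite.f_integrable mlam.
have rn_ae : ae_eq lambda setT
    (Radon_Nikodym_SigmaFinite.f m lambda) (EFin \o p).
  apply: integral_ae_eq => //; first exact/measurable_EFinP.
  move=> E _ mE; rewrite -Radon_Nikodym_SigmaFinite.f_integral//.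
  by case: mp => _ _; exact.
apply: ae_eq_integral => //.
- by apply: emeasurable_funM => //; exact: measurable_int int_rn.
- by apply: emeasurable_funM => //; exact/measurable_EFinP.
- exact: ae_eqe_mul2l.
Qed.

Lemma integral_density (g : X -> \bar R) : measurable_fun setT g ->
  (\int[m]_x g x = \int[lambda]_x (g x * (p x)%:E))%E.
Proof.
move=> mg; rewrite integralE [RHS]integralE.
rewrite !ge0_integral_density//; last 2 first.
- exact: measurable_funeneg.
- exact: measurable_funepos.
congr (_ - _)%E; apply: eq_integral => x _.
  by rewrite !funeposE maxe_pMl ?lee_fin// mul0e.
by rewrite !funenegE maxe_pMl ?lee_fin// mul0e mulNe.
Qed.

Lemma integrable_density (g : X -> R) : m.-integrable setT (EFin \o g) ->
  lambda.-integrable setT (EFin \o (fun x => g x * p x)).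
Proof.
move=> ig; have /integrableP[mg fin_g] := ig.
apply/integrableP; split.
  by apply/measurable_EFinP/measurable_funM => //; exact/measurable_EFinP.
move: fin_g; rewrite ge0_integral_density//; last exact: measurableT_comp.
apply: le_lt_trans; rewrite le_eqVlt; apply/orP; left; apply/eqP.
apply: eq_integral => x _ /=.
by rewrite normrM (ger0_norm (p_ge0 x)).
Qed.

Lemma Rintegral_density (g : X -> R) : m.-integrable setT (EFin \o g) ->
  \int[m]_x g x = \int[lambda]_x (g x * p x).
Proof.
move=> ig; rewrite /Rintegral integral_density; last exact: measurable_int ig.
by congr fine; apply: eq_integral => x _; rewrite EFinM.
Qed.

End density.

(** The additivity and scaling formulas for measures hold without
    integrability for nonnegative measurable functions, so they are applied to
    the positive and negative parts of [g], whose integrals are finite. *)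
Lemma Rintegral_contamination (Q : probability X R) (e : R) (x : X)
    (g : X -> R) : 0 < e < 1 -> Q.-integrable setT (EFin \o g) ->
  \int[contamination Q e x]_y g y = (1 - e) * \int[Q]_y g y + e * g x.
Proof.
move=> /andP[e0 e1] ig.
have eE : clamp01 e = e by rewrite /clamp01 min_r ?max_r// ltW.
have mg : measurable_fun setT (EFin \o g) by exact: measurable_int ig.
have ge0_part (k : X -> \bar R) : measurable_fun setT k ->
    (forall y, 0 <= k y)%E ->
    (\int[contamination Q e x]_y k y =
     (1 - e)%:E * \int[Q]_y k y + e%:E * k x)%E.
  move=> mk k0; rewrite ge0_integral_measure_add//.
  rewrite !ge0_integral_mscale//= integral_dirac// diracT mul1e.
  by rewrite eE.
have fpos : (\int[Q]_y (EFin \o g)^\+ y)%E \is a fin_num.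
  exact: integrable_pos_fin_num.
have fneg : (\int[Q]_y (EFin \o g)^\- y)%E \is a fin_num.
  exact: integrable_neg_fin_num.
rewrite /Rintegral integralE [in RHS]integralE.
rewrite !ge0_part//; last 2 first.
- exact: measurable_funeneg.
- exact: measurable_funepos.
move: fpos fneg => /fineK <- /fineK <-.
rewrite funeposE funenegE /=.
have maxE (r : R) : maxe r%:E 0%E = (Num.max r 0)%:E by rewrite EFin_max.
rewrite !maxE /=.
have gE : g x = Num.max (g x) 0 - Num.max (- g x) 0.
  by rewrite -[in LHS](funrposBneg g).
rewrite [in RHS]gE; ring.
Qed.

End measures.

(** * Fisher consistency *)

Section divergence.
Context {R : realType}.
Implicit Types a b : R.

Lemma ln_lt_subr1 (z : R) : 0 < z -> z != 1 -> ln z < z - 1.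
Proof.
move=> z0 z1; rewrite ltrBrDl -[X in _ < X](lnK z0).
by apply: expR_gt1Dx; rewrite ln_eq0.
Qed.

(** With [a] and [b] the values of two probability densities at a point, this
    is the Kullback-Leibler integrand [a ln (a / b)] made pointwise positive
    by the term [b - a], whose integral is 0. *)
Lemma kl_gap_gt0 a b : 0 < a -> 0 < b -> b != a ->
  0 < b - a - (ln b * a - ln a * a).
Proof.
move=> a0 b0 ab.
have ba0 : 0 < b / a by rewrite divr_gt0.
have ba1 : b / a != 1.
  by apply: contraNneq ab => ba1; rewrite -[b](divfK (lt0r_neq0 a0)) ba1 mul1r.
have := ln_lt_subr1 ba0 ba1.
rewrite ln_div ?posrE// -(ltr_pM2r a0) mulrBl mulrBl mul1r divfK ?gt_eqF//.
by rewrite subr_gt0.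
Qed.

(** A positive multiple of the integrand of the density power divergence.
    After division by [b `^ alpha * a] the claim is [(a / b) `^ alpha > 1 - alpha * (b / a - 1)],
    which follows from [expR y >= 1 + y] and the strict bound
    [ln (b / a) < b / a - 1]. *)
Lemma power_gap_gt0 (alpha a b : R) : 0 < alpha -> 0 < a -> 0 < b -> b != a ->
  0 < alpha * b `^ (1 + alpha) - (1 + alpha) * (b `^ alpha * a) +
      a `^ (1 + alpha).
Proof.
move=> alpha0 a0 b0 ab.
have powE (z : R) : 0 < z -> z `^ (1 + alpha) = z * z `^ alpha.
  move=> z0; rewrite powRD ?powRr1// ?ltW//.
  by rewrite (gt_eqF z0) implybT.
have ba0 : 0 < b / a by rewrite divr_gt0.
have ba1 : b / a != 1.
  by apply: contraNneq ab => ba1; rewrite -[b](divfK (lt0r_neq0 a0)) ba1 mul1r.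
have ln_ba := ln_lt_subr1 ba0 ba1.
have bpow0 : 0 < b `^ alpha by exact: powR_gt0.
have apowE : a `^ alpha = b `^ alpha * expR (- (alpha * ln (b / a))).
  rewrite /powR !gt_eqF// -expRD ln_div ?posrE//; congr expR; ring.
have exp_gt : 1 - alpha * (b / a - 1) < expR (- (alpha * ln (b / a))).
  apply: (lt_le_trans _ (expR_ge1Dx _)).
  by rewrite ltrD2l ltrN2 ltr_pM2l.
rewrite !powE// apowE.
have -> : alpha * (b * b `^ alpha) - (1 + alpha) * (b `^ alpha * a) +
    a * (b `^ alpha * expR (- (alpha * ln (b / a)))) =
    b `^ alpha * a * (expR (- (alpha * ln (b / a))) - (1 - alpha * (b / a - 1))).
  by field; rewrite gt_eqF.
by rewrite mulr_gt0 ?mulr_gt0// subr_gt0.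
Qed.

Lemma gap_ae_eq {disp : measure_display} {X : measurableType disp}
    (mu : {measure set X -> \bar R}) (f g gap : X -> R) :
  mu.-integrable setT (EFin \o gap) -> \int[mu]_x gap x <= 0 ->
  (forall x, f x != g x -> 0 < gap x) -> (forall x, f x = g x -> gap x = 0) ->
  ae_eq mu setT (EFin \o f) (EFin \o g).
Proof.
move=> igap gap_le0 gap_gt0 gap0.
have gap_ge0 x : 0 <= gap x.
  by have [/gap0 ->//|/gap_gt0/ltW] := eqVneq (f x) (g x).
have int0 : (\int[mu]_x `|(gap x)%:E| = 0)%E.
  under eq_integral do rewrite gee0_abs ?lee_fin//.
  rewrite -[LHS]fineK; last exact: integrable_fin_num igap.
  by congr EFin; apply/eqP; rewrite eq_le gap_le0 Rintegral_ge0.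
have := (ae_eq_integral_abs mu measurableT (measurable_int _ igap)).1 int0.
apply: filterS => x /(_ Logic.I) [gapx] _ /=; congr EFin.
apply/eqP; apply: contraT => /gap_gt0.
by rewrite gapx ltxx.
Qed.

End divergence.

Section fisher.
Context {disp : measure_display} {X : measurableType disp} {R : realType}.
Context {d : nat}.
Variables (lambda : {sigma_finite_measure set X -> \bar R}).
Variables (Theta : set 'cV[R]_d) (P : 'cV[R]_d -> probability X R).
Variables (P0 : probability X R) (p : 'cV[R]_d -> X -> R) (alpha : R).

(** The model integrals of the criterion, all rewritten as [lambda]-integrals,
    assemble into the integral of the gap between [p u] and [p t], so
    optimality of [u] at [P t] says that this integral is at most 0. *)
Lemma power_estimate_model (t u : 'cV[R]_d) :
  0 <= alpha -> model_family lambda Theta P p -> smooth_densities Theta p ->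
  expectations_exist lambda Theta P P0 p alpha ->
  Theta t -> power_estimate lambda Theta p alpha (P t) u -> u = t.
Proof.
move=> alpha0 [dens _ _ ident] smooth ints tT [uT opt].
apply/ident => // A mA; rewrite /eq_measure.
have [dt du] := (dens t tT, dens u uT).
have pos v x : Theta v -> 0 < p v x by move=> vT; have [] := smooth v x vT.
have intP v : Theta v -> (P t).-integrable setT (fun x =>
    (if alpha == 0 then ln (p v x) else p v x `^ alpha)%:E).
  by move=> vT; have [_ _ /(_ (P t)) []] := ints v vT; first by left; exists t.
have intL v : Theta v -> lambda.-integrable setT (EFin \o (p v)).
  by move=> /dens/density_integrable.
have intA v : Theta v -> lambda.-integrable setT
    (EFin \o (fun x => p v x `^ (1 + alpha))).
  by move=> vT; have [] := ints v vT.
suff puE : ae_eq lambda setT (EFin \o p u) (EFin \o p t).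
  have [mu _ ->//] := du; have [mt _ ->//] := dt.
  apply: ae_eq_integral => //.
  - by apply/measurable_EFinP; exact: measurable_funTS.
  - by apply/measurable_EFinP; exact: measurable_funTS.
  - exact: ae_eq_subset puE.
have [alpha_eq0|alpha_neq0] := eqVneq alpha 0.
  move: opt intP; rewrite alpha_eq0 eqxx => opt intP.
  have intB v : Theta v ->
      lambda.-integrable setT (EFin \o (fun x => ln (p v x) * p t x)).
    by move=> vT; apply: (integrable_density dt); exact: intP.
  have [iu it] := (intL u uT, intL t tT).
  have [ibu ibt] := (intB u uT, intB t tT).
  have igap1 : lambda.-integrable setT (EFin \o (fun x => p u x - p t x)).
    exact: (integrableB measurableT iu it).
  have igap2 : lambda.-integrable setT
      (EFin \o (fun x => ln (p u x) * p t x - ln (p t x) * p t x)).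
    exact: (integrableB measurableT ibu ibt).
  have igap : lambda.-integrable setT (EFin \o (fun x =>
      p u x - p t x - (ln (p u x) * p t x - ln (p t x) * p t x))).
    exact: (integrableB measurableT igap1 igap2).
  apply: (gap_ae_eq igap).
  - rewrite (RintegralB measurableT igap1 igap2) (RintegralB measurableT iu it).
    rewrite (RintegralB measurableT ibu ibt).
    rewrite -!(Rintegral_density dt); [|exact: intP..].
    have mass v : Theta v -> \int[lambda]_x p v x = 1.
      move=> /dens[_ _ /(_ setT measurableT) PvT].
      by rewrite /Rintegral -PvT probability_setT.
    rewrite !mass// subrr sub0r opprB subr_le0.
    exact: opt.
  - by move=> x; apply: kl_gap_gt0; exact: pos.
  - by move=> x ->; ring.
have alpha_gt0 : 0 < alpha by rewrite lt_neqAle eq_sym alpha_neq0.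
move: opt intP; rewrite (negbTE alpha_neq0) => opt intP.
have intB v : Theta v ->
    lambda.-integrable setT (EFin \o (fun x => p v x `^ alpha * p t x)).
  by move=> vT; apply: (integrable_density dt); exact: intP.
have [ibu iau iat] := And3 (intB u uT) (intA u uT) (intA t tT).
have i1 : lambda.-integrable setT
    (EFin \o (fun x => alpha * p u x `^ (1 + alpha))).
  exact: (integrableZl measurableT _ iau).
have i2 : lambda.-integrable setT
    (EFin \o (fun x => (1 + alpha) * (p u x `^ alpha * p t x))).
  exact: (integrableZl measurableT _ ibu).
have i12 : lambda.-integrable setT (EFin \o (fun x =>
    alpha * p u x `^ (1 + alpha) - (1 + alpha) * (p u x `^ alpha * p t x))).
  exact: (integrableB measurableT i1 i2).
have igap : lambda.-integrable setT (EFin \o (fun x =>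
    alpha * p u x `^ (1 + alpha) - (1 + alpha) * (p u x `^ alpha * p t x) +
    p t x `^ (1 + alpha))).
  exact: (integrableD measurableT i12 iat).
have powE x : p t x `^ (1 + alpha) = p t x `^ alpha * p t x.
  have ptx : 0 < p t x by exact: pos.
  rewrite powRD ?powRr1 1?mulrC// ?ltW//.
  by rewrite (gt_eqF ptx) implybT.
apply: (gap_ae_eq igap).
- rewrite (RintegralD measurableT i12 iat) (RintegralB measurableT i1 i2).
  rewrite (RintegralZl _ measurableT iau) (RintegralZl _ measurableT ibu).
  have int_t : \int[lambda]_x (p t x `^ (1 + alpha)) =
      \int[P t]_x (p t x `^ alpha).
    rewrite (Rintegral_density dt (intP t tT)).
    by apply: eq_Rintegral => x _; exact: powE.
  rewrite -(Rintegral_density dt (intP u uT)).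
  have := opt t tT; rewrite /criterion int_t.
  set Iu := \int[lambda]_x _; set Bu := \int[P t]_x (p u x `^ alpha).
  set It := \int[P t]_x _ => ineq.
  (* Multiplying the criteria by [alpha * (1 + alpha)] produces the gap. *)
  have alpha1 : 0 < 1 + alpha by rewrite addr_gt0.
  have := ler_wpM2l (ltW (mulr_gt0 alpha_gt0 alpha1)) ineq.
  have -> : alpha * (1 + alpha) * ((1 + alpha)^-1 * Iu - alpha^-1 * Bu) =
      alpha * Iu - (1 + alpha) * Bu by field; rewrite !gt_eqF.
  have -> : alpha * (1 + alpha) * ((1 + alpha)^-1 * It - alpha^-1 * It) = - It.
    by field; rewrite !gt_eqF.
  by rewrite -subr_le0 opprK.
- by move=> x; apply: power_gap_gt0 => //; exact: pos.
- by move=> x ->; rewrite powE; ring.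
Qed.

End fisher.

(** * Entrywise expectations *)

Section expectation.
Context {disp : measure_display} {X : measurableType disp} {R : realType}.

Lemma expectD (mu : {measure set X -> \bar R}) {m n : nat}
    (F G : X -> 'M[R]_(m, n)) : expect_exists mu F -> expect_exists mu G ->
  expect mu (fun x => F x + G x) = expect mu F + expect mu G.
Proof.
move=> iF iG; apply/matrixP => i j; rewrite !mxE.
rewrite -(RintegralD measurableT (iF i j) (iG i j)).
by apply: eq_Rintegral => x _; rewrite mxE.
Qed.

Lemma expect_exists_subcst (Q : probability X R) {m n : nat}
    (F : X -> 'M[R]_(m, n)) (c : 'M[R]_(m, n)) : expect_exists Q F ->
  expect_exists Q (fun x => F x - c).
Proof.
move=> iF i j.
have ic : Q.-integrable setT (EFin \o cst (c i j)).
  exact: finite_measure_integrable_cst.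
apply: eq_integrable (integrableB measurableT (iF i j) ic) => // x _ /=.
by rewrite !mxE.
Qed.

Lemma expect_subcst (Q : probability X R) {m n : nat}
    (F : X -> 'M[R]_(m, n)) (c : 'M[R]_(m, n)) : expect_exists Q F ->
  expect Q (fun x => F x - c) = expect Q F - c.
Proof.
move=> iF; apply/matrixP => i j; rewrite !mxE.
have ic : Q.-integrable setT (EFin \o cst (c i j)).
  exact: finite_measure_integrable_cst.
have cE : \int[Q]_x cst (c i j) x = c i j.
  rewrite (Rintegral_cst _ measurableT).
  rewrite -[RHS]mulr1; congr (_ * _).
  exact: (congr1 fine (probability_setT Q)).
rewrite -[in RHS]cE -(RintegralB measurableT (iF i j) ic).
by apply: eq_Rintegral => x _; rewrite !mxE.
Qed.

Lemma expect_contamination (Q : probability X R) (e : R) (x : X) {m n : nat}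
    (F : X -> 'M[R]_(m, n)) : 0 < e < 1 -> expect_exists Q F ->
  expect (contamination Q e x) F = (1 - e) *: expect Q F + e *: F x.
Proof.
move=> e01 iF; apply/matrixP => i j; rewrite !mxE.
exact: (Rintegral_contamination x e01 (iF i j)).
Qed.

Lemma expect_density (lambda : {sigma_finite_measure set X -> \bar R})
    (Q : probability X R) (q : X -> R) {m n : nat} (F : X -> 'M[R]_(m, n)) :
  is_density lambda Q q -> expect_exists Q F ->
  expect Q F = expect lambda (fun x => q x *: F x).
Proof.
move=> dq iF; apply/matrixP => i j; rewrite !mxE.
rewrite (Rintegral_density dq (iF i j)).
by apply: eq_Rintegral => x _; rewrite mxE mulrC.
Qed.

End expectation.

(** * The linear equation for the influence function *)

Section influence_equation.
Context {disp : measure_display} {X : measurableType disp} {R : realType}.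
Context {d : nat}.
Variables (lambda : {sigma_finite_measure set X -> \bar R}).
Variables (Theta : set 'cV[R]_d) (P : 'cV[R]_d -> probability X R).
Variables (P0 : probability X R) (p : 'cV[R]_d -> X -> R) (alpha : R).
Variable T : probability X R -> 'cV[R]_d.
Hypotheses (model : model_family lambda Theta P p)
  (smooth : smooth_densities Theta p)
  (ints : expectations_exist lambda Theta P P0 p alpha)
  (interchange : derivative_integral_interchange lambda Theta P P0 p alpha)
  (opt : power_functional lambda Theta P P0 p alpha T)
  (est : solves_estimating_equation Theta P P0 p alpha T).

(** The [lambda]-integral form of [P_u . p_u^alpha s_u] for [u] in the
    parameter set; its integrating measure is fixed, so it can be
    differentiated under the integral sign. *)
Let K u := expect lambda (fun x => p u x `^ (1 + alpha) *: score p u x).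

Let powE u x : Theta u -> p u x `^ (1 + alpha) = p u x * p u x `^ alpha.
Proof.
move=> /smooth-/(_ x)[pux _].
by rewrite powRD ?powRr1// ?ltW// (gt_eqF pux) implybT.
Qed.

Lemma calPplus_model t : Theta t -> calPplus Theta P P0 (P t).
Proof. by move=> tT; left; exists t. Qed.

Lemma expect_model_pscore u : Theta u ->
  expect (P u) (pscore p alpha u) =
  expect lambda (fun x => p u x `^ (1 + alpha) *: score p u x).
Proof.
move=> uT; have [dens _ _ _] := model.
have [_ _ /(_ _ (calPplus_model uT))[_ ips _]] := ints uT.
rewrite (expect_density (dens u uT) ips); congr expect.
by apply/funext => x; rewrite scalerA powE.
Qed.

Lemma diff_expect_pscore Q t v : calPplus Theta P P0 Q -> Theta t ->
  'd (fun u => expect Q (pscore p alpha u)) t v =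
  expect Q (Pi_mx p alpha t) *m v.
Proof.
move=> QP tT; have [_ /(_ _ QP)[dG jG]] := interchange tT.
rewrite (diff_jacobian_mx _ dG) jG; congr (expect _ _ *m _).
apply/funext => x; have [ptx p2] := smooth x tT.
exact: (jacobian_powR_score ptx p2).
Qed.

Lemma diff_expect_model t v : Theta t ->
  'd K t v = expect (P t) (fun x => Pi_mx p alpha t x + pss p alpha t x) *m v.
Proof.
move=> tT; have [[dK jK] _] := interchange tT.
have [dens _ _ _] := model.
have [_ ipss /(_ _ (calPplus_model tT))[_ _ iPi]] := ints tT.
rewrite (diff_jacobian_mx _ dK) jK; congr (_ *m _).
rewrite (expect_density (dens t tT)); last first.
  move=> i j.
  apply: eq_integrable (integrableD measurableT (iPi i j) (ipss i j)) => //.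
  by move=> x _ /=; rewrite -EFinD [in RHS]mxE.
congr expect; apply/funext => x; have [ptx p2] := smooth x tT.
rewrite (jacobian_powR_score ptx p2) powE// -scalerA; congr (_ *: _).
rewrite -scalerDr; congr (_ *: _).
by rewrite scalerDl scale1r -[in LHS]addrA addrC.
Qed.

(** The difference of the estimating equations at [Q_{e,x}] and [Q], divided by
    [e], has this equation as its limit for [e] tending to 0 from the right. *)
Lemma influence_equation Q x : calPplus Theta P P0 Q -> influence_exists T Q ->
  I_mx P p alpha T Q *m IF T x Q = - psi P p alpha x (T Q).
Proof.
move=> QP /(_ x) cvgIF.
have hl : e^-1 *: (T (contamination Q e x) - T Q) @[e --> 0^'+] --> IF T x Q.
  exact: cvgIF.
set l := IF T x Q in hl *.
have QQ : calQ Theta P P0 Q by left.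
have QT : Theta (T Q) by have [] := opt (or_introl QQ).
have mixT e : 0 < e < 1 -> calQ_mix Theta P P0 (contamination Q e x).
  by move=> e01; right; exists Q, e, x; split.
pose h e := T (contamination Q e x).
pose G u := expect Q (pscore p alpha u).
have ips u : Theta u -> expect_exists Q (pscore p alpha u).
  by move=> uT; have [_ _ /(_ Q QP)[]] := ints uT.
have eqQ : G (T Q) = K (T Q).
  have := est (or_introl QQ).
  rewrite /psi expect_subcst ?expect_model_pscore//; last exact: ips.
  by move/subr0_eq.
have eq_mix e : 0 < e < 1 ->
    e^-1 *: (G (h e) - G (T Q)) - e^-1 *: (K (h e) - K (T Q)) =
    G (h e) - pscore p alpha (h e) x.
  move=> e01; have [heT _] := opt (mixT e e01).
  have := est (mixT e e01).
  rewrite /psi expect_contamination//; last exact/expect_exists_subcst/ips.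
  rewrite expect_subcst; last exact: ips.
  rewrite expect_model_pscore// -/(K _) -/(G _) -/(h _) => eq0.
  rewrite -scalerBr eqQ opprB addrA subrK.
  apply: (scalerI (a := e)); first by rewrite gt_eqF//; case/andP: e01.
  rewrite scalerA divff ?scale1r; last by rewrite gt_eqF//; case/andP: e01.
  apply/eqP; rewrite -subr_eq0 -[X in _ == X]eq0; apply/eqP/matrixP => i j.
  by rewrite !mxE; ring.
have [dG _] : interchangeable Q (pscore p alpha) (T Q).
  by have [_] := interchange QT; exact.
have [[dK _] _] := interchange QT.
have limG := cvg_quotient_diff dG hl.
have limK := cvg_quotient_diff dK hl.
have FF : Filter (0 : R)^'+ by exact: filter_filter.
have hT : h e @[e --> 0^'+] --> T Q.
  have e_to0 : e @[e --> (0 : R)^'+] --> (0 : R).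
    exact: cvg_at_right_filter cvg_id.
  have hT0 : e *: (e^-1 *: (h e - T Q)) + T Q @[e --> 0^'+] --> T Q.
    rewrite -[X in _ --> X]add0r -(scale0r l).
    exact: cvgD (cvgZ e_to0 hl) (cvg_cst (T Q)).
  suff near_h : \forall e \near 0^'+, e *: (e^-1 *: (h e - T Q)) + T Q = h e.
    exact: cvg_trans (near_eq_cvg near_h) hT0.
  near=> e.
  by rewrite scalerA divff ?scale1r ?subrK.
have limR : G (h e) - pscore p alpha (h e) x @[e --> 0^'+] -->
    G (T Q) - pscore p alpha (T Q) x.
  have [ptx p2] := smooth x QT.
  apply: cvgB.
    by have := cvg_comp _ _ hT (differentiable_continuous dG).
  by have := cvg_comp _ _ hT (continuous_powR_score ptx p2 (a := alpha)).
have near_eq : \forall e \near 0^'+, G (h e) - pscore p alpha (h e) x =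
    e^-1 *: (G (h e) - G (T Q)) - e^-1 *: (K (h e) - K (T Q)).
  near=> e; rewrite eq_mix//.
  by apply/andP; split; near: e; [exact: nbhs_right_gt|exact: nbhs_right_lt].
have limL : e^-1 *: (G (h e) - G (T Q)) - e^-1 *: (K (h e) - K (T Q))
   @[e --> 0^'+] --> 'd G (T Q) l - 'd K (T Q) l.
  exact: cvgB limG limK.
have limE : 'd G (T Q) l - 'd K (T Q) l = G (T Q) - pscore p alpha (T Q) x.
  suff limL' : e^-1 *: (G (h e) - G (T Q)) - e^-1 *: (K (h e) - K (T Q))
      @[e --> 0^'+] --> G (T Q) - pscore p alpha (T Q) x.
    exact: (cvg_unique (@norm_hausdorff _ _) limL limL').
  exact: cvg_trans (near_eq_cvg near_eq) limR.
rewrite /I_mx mulmxBl -diff_expect_pscore// -diff_expect_model// limE.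
by rewrite eqQ /psi expect_model_pscore// opprB.
Unshelve. all: by end_near. Qed.

End influence_equation.

Theorem theorem3p1p5 (R : realType) (disp : measure_display)
    (X : measurableType disp) (d : nat)
    (lambda : {sigma_finite_measure set X -> \bar R})
    (Theta : set 'cV[R]_d)
    (P : 'cV[R]_d -> probability X R) (P0 : probability X R)
    (p : 'cV[R]_d -> X -> R)
    (alpha : R) (T : probability X R -> 'cV[R]_d) :
  (0 < d)%N ->
  0 <= alpha ->
  model_family lambda Theta P p ->
  true_measure Theta P P0 ->
  smooth_densities Theta p ->
  expectations_exist lambda Theta P P0 p alpha ->
  derivative_integral_interchange lambda Theta P P0 p alpha ->
  power_functional lambda Theta P P0 p alpha T ->
  solves_estimating_equation Theta P P0 p alpha T ->
  (forall Q, calPplus Theta P P0 Q ->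
     I_mx P p alpha T Q \in unitmx ->
     influence_exists T Q ->
     forall x, IF T x Q =
       - (invmx (I_mx P p alpha T Q) *m
            (p (T Q) x `^ alpha *: score p (T Q) x
             - expect (P (T Q)) (fun y => p (T Q) y `^ alpha *: score p (T Q) y)))) /\
  (forall t, Theta t ->
     I_mx P p alpha T (P t) = I_model P p alpha t /\
     (I_model P p alpha t \in unitmx ->
      influence_exists T (P t) ->
      forall x, IF T x (P t) =
        - (invmx (I_model P p alpha t) *m
             (p t x `^ alpha *: score p t x
              - expect (P t) (fun y => p t y `^ alpha *: score p t y))))).
Proof.
move=> _ alpha_ge0 model _ smooth ints diff opt est.
have influence_formula Q : calPplus Theta P P0 Q ->
    I_mx P p alpha T Q \in unitmx -> influence_exists T Q -> forall x,
    IF T x Q = - (invmx (I_mx P p alpha T Q) *m psi P p alpha x (T Q)).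
  move=> QP unitI existsIF x.
  rewrite -mulmxN -(influence_equation model smooth ints diff opt est)//.
  by rewrite mulKmx.
split=> // t tT.
have PtP := calPplus_model P P0 tT.
have TtE : T (P t) = t.
  apply: (power_estimate_model alpha_ge0 model smooth ints tT).
  by apply: opt; left; left.
have IE : I_mx P p alpha T (P t) = I_model P p alpha t.
  have [_ ipss /(_ _ PtP)[_ _ iPi]] := ints t tT.
  by rewrite /I_mx /I_model TtE expectD// opprD addrA subrr add0r.
split=> // unitI existsIF x.
by have := influence_formula _ PtP; rewrite IE TtE; exact.
Qed.
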